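(* Let $G=(V,E)$ be a directed graph whose chromatic number is finite. Then $G\in\mathfrak{Out}_2$, i.e. there is an independent set $A\subseteq V$ such that for each $v\in V$ there is a directed path of length at most $2$ from some point of $A$ to $v$.
   Context: Digraphs $G=(V,E)$, $E\subseteq V\times V$, may be infinite. A set $A\subseteq V$ is independent if there is no edge (in either direction) between two distinct elements of $A$. Paths of length $0$ are allowed. The chromatic number of $G$ is the least number of independent sets into which $V$ can be partitioned (i.e. the chromatic number of the underlying undirected graph). *)

(* Defs.v *)
From mathcomp Require Import all_boot.
From mathcomp Require Import boolp classical_sets functions cardinality.
Set Implicit Arguments.
Unset Strict Implicit.
Unset Printing Implicit Defensive.
Local Open Scope classical_set_scope.

(* The vertex type is arbitrary (possibly empty or infinite); loops and pairs
   of opposite edges are allowed. *)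
Record digraph := Digraph {
  vertex :> Type;
  edge : set (vertex * vertex) }.

Definition independent (G : digraph) (A : set G) : Prop :=
  forall x y : G, A x -> A y -> x <> y -> ~ edge (x, y).

(* The blocks are indexed by `I_n = {0, .., n - 1}; [partition] requires them to
   be nonempty, so n is exactly the number of blocks. *)
Definition independent_partition (G : digraph) (n : nat) : Prop :=
  exists F : nat -> set G,
    partition `I_n F [set: G] /\ forall i, `I_n i -> independent (F i).

Definition is_chromatic_number (G : digraph) (n : nat) : Prop :=
  independent_partition G n /\
  forall m, independent_partition G m -> (n <= m)%N.

Definition finite_chromatic_number (G : digraph) : Prop :=
  exists n : nat, is_chromatic_number G n.

(* Only the values p 0, .., p n matter. They are required to be distinct, as is
   usual for paths (as opposed to walks). *)
Definition dipath (G : digraph) (n : nat) (p : nat -> G) : Prop :=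
  set_inj `I_n.+1 p /\ forall i, (i < n)%N -> edge (p i, p i.+1).

Definition reach_within (G : digraph) (k : nat) (x y : G) : Prop :=
  exists n (p : nat -> G), [/\ (n <= k)%N, dipath n p, p 0%N = x & p n = y].

Definition Out (k : nat) (G : digraph) : Prop :=
  exists A : set G, independent A /\
    forall v : G, exists2 a, A a & reach_within k a v.

(* Main.v *)
Require Import Defs.
From mathcomp Require Import all_boot.
From mathcomp Require Import boolp classical_sets functions cardinality.
Set Implicit Arguments.
Unset Strict Implicit.
Unset Printing Implicit Defensive.
Local Open Scope classical_set_scope.

(* Induction on the number of independent sets covering the vertices. Let I be
   one of them, and let A be an independent set solving the problem on the
   vertices that lie neither in I nor in the out-neighbourhood of I. No edge
   leads from I to A, so adding to A the points of I that receive no edge from A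
   keeps it independent. The remaining points of I are at distance 1 from A, so
   the out-neighbours of I are at distance at most 2 from the new set. *)

(** Walks instead of paths: the vertices may coincide, so the induction needs no distinctness
    checks. *)
Definition reach2 (G : digraph) (x y : G) : Prop :=
  [\/ x = y, edge (x, y) | exists2 z, edge (x, z) & edge (z, y)].

Lemma reach_within0 (G : digraph) k (x : G) : reach_within k x x.
Proof.
exists 0%N, (fun=> x); split=> //; split=> // i j.
by rewrite !inE /= !ltnS !leqn0 => /eqP-> /eqP->.
Qed.

Lemma reach_within_edge (G : digraph) k (x y : G) :
  edge (x, y) -> reach_within k.+1 x y.
Proof.
move=> xy; have [<-|nxy] := pselect (x = y); first exact: reach_within0.
exists 1%N, (fun i => if i is 0 then x else y); split=> //; split=> [|[|i]//].
by move=> [|[|i]] [|[|j]]; rewrite ?inE //= => _ _ // /esym.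
Qed.

(** Any coincidence among the vertices of the walk shortens it to a path. *)
Lemma reach2_within (G : digraph) (x y : G) : reach2 x y -> reach_within 2 x y.
Proof.
case=> [<-|/reach_within_edge//|[z xz zy]]; first exact: reach_within0.
have [<-|nxy] := pselect (x = y); first exact: reach_within0.
have [xz_eq|nxz] := pselect (x = z).
  by apply: reach_within_edge; rewrite xz_eq.
have [zy_eq|nzy] := pselect (z = y).
  by apply: reach_within_edge; rewrite -zy_eq.
exists 2, (fun i => match i with 0 => x | 1 => z | _ => y end).
split=> //; split=> [|[|[|i]]//].
by move=> [|[|[|i]]] [|[|[|j]]]; rewrite ?inE //= => _ _ // /esym.
Qed.

(** Relativized to a covered subset [S] so that the induction can delete vertices while [G] and [F]
    stay fixed. *)
Lemma covered_reach2 (G : digraph) (n : nat) (F : nat -> set G) (S : set G) :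
  (forall i, (i < n)%N -> independent (F i)) ->
  S `<=` \bigcup_(i in `I_n) F i ->
  exists A : set G, [/\ A `<=` S, independent A &
    forall v, S v -> exists2 a, A a & reach2 a v].
Proof.
elim: n S => [|n IHn] S indF covS.
  by exists set0; split=> // v /covS[].
pose I := S `&` F n.
pose hit v := exists2 y, I y & edge (y, v).
have [i i_n|x [[Sx nFx] _]|A [AS' indA reachA]] :=
    IHn ((S `\` F n) `\` [set v | hit v]).
- by apply: indF; exact: ltnW.
- have [i /=] := covS x Sx.
  rewrite ltnS leq_eqVlt => /orP[/eqP-> //|i_n Fx].
  by exists i.
pose J := I `&` [set x | ~ exists2 a, A a & edge (a, x)].
exists (A `|` J); split.
- by move=> x [/AS'[[]]//|[[]]].
(* Edges from [A] to [J] contradict the choice of [J]; edges from [J] to [A] would make their head a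
   [hit] vertex, which [A] avoids. *)
- move=> x y [Ax|[Ix nAx]] [Ay|[Iy nAy]] xy e.
  + exact: indA e.
  + by apply: nAy; exists x.
  + by have [_] := AS' y Ay; apply; exists x.
  + exact: (indF n (ltnSn n) x y Ix.2 Iy.2 xy).
have I_cover x : I x -> J x \/ exists2 a, A a & edge (a, x).
  by move=> Ix; have [|nA] := pselect (exists2 a, A a & edge (a, x));
    [right|left].
move=> v Sv; have [Fv|nFv] := pselect (F n v).
  have [Jv|[a Aa av]] := I_cover v (conj Sv Fv).
    by exists v; [right|constructor 1].
  by exists a; [left|constructor 2].
have [[y Iy yv]|nhit] := pselect (hit v).
  have [Jy|[a Aa ay]] := I_cover y Iy.
    by exists y; [right|constructor 2].
  by exists a; [left|constructor 3; exists y].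
have [//|a Aa av] := reachA v.
by exists a; [left|].
Qed.

Theorem corollary2p4 (G : digraph) : finite_chromatic_number G -> Out 2 G.
Proof.
move=> [n [[F [[covF _ _] indF]] _]].
have [|A [_ indA reachA]] := @covered_reach2 G n F setT indF.
  by rewrite -covF.
exists A; split=> // v; have [//|a Aa av] := reachA v.
by exists a => //; exact: reach2_within.
Qed.
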